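(* The ai-semirings $\mathcal{A}_2^1$ and $\mathrm{End}(\mathcal{C}_3)$ admit no finite identity basis.
   Context: An ai-semiring is a structure $(R,+,\cdot)$ with $(R,+)$ a semilattice, $(R,\cdot)$ a semigroup, and multiplication distributing over addition on both sides. $\mathcal{C}_3$ is the chain $0<1<2$ viewed as a semilattice with $k+\ell=\max\{k,\ell\}$; $\mathrm{End}(\mathcal{C}_3)$ is the set of its endomorphisms (order-preserving self-maps of $\{0,1,2\}$) with pointwise addition $x(\alpha+\beta)=x\alpha+x\beta$ and composition $x(\alpha\beta)=(x\alpha)\beta$. $\mathcal{A}_2^1$ is the subsemiring of $\mathrm{End}(\mathcal{C}_3)$ consisting of all endomorphisms fixing $2$; as a monoid it is $A_2^1$, where $A_2=\langle e,a\mid eae=e^2=e,\ aea=a,\ a^2=0\rangle$ with an identity adjoined. An identity basis is a set of identities valid in the structure from which all its identities follow. *)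

(* Defs.v *)
From Stdlib Require List.
From mathcomp Require Import all_boot.
Set Implicit Arguments. Unset Strict Implicit. Unset Printing Implicit Defensive.

Inductive term : Type :=
| Var : nat -> term
| Add : term -> term -> term
| Mul : term -> term -> term.

Definition identity := (term * term)%type.

Record sig_alg := SigAlg {
  car :> Type;
  sadd : car -> car -> car;
  smul : car -> car -> car }.

Fixpoint eval (A : sig_alg) (v : nat -> A) (t : term) : A :=
  match t with
  | Var n => v n
  | Add s u => sadd (eval v s) (eval v u)
  | Mul s u => smul (eval v s) (eval v u)
  end.

Definition holds (A : sig_alg) (e : identity) : Prop :=
  forall v : nat -> A, eval v e.1 = eval v e.2.

Fixpoint subst (s : nat -> term) (t : term) : term :=
  match t with
  | Var n => s n
  | Add a b => Add (subst s a) (subst s b)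
  | Mul a b => Mul (subst s a) (subst s b)
  end.

Inductive derives (Sigma : list identity) : term -> term -> Prop :=
| der_ax : forall u v (s : nat -> term), List.In (u, v) Sigma ->
    derives Sigma (subst s u) (subst s v)
| der_refl : forall t, derives Sigma t t
| der_sym : forall u v, derives Sigma u v -> derives Sigma v u
| der_trans : forall u v w, derives Sigma u v -> derives Sigma v w ->
    derives Sigma u w
| der_add : forall u u' v v', derives Sigma u u' -> derives Sigma v v' ->
    derives Sigma (Add u v) (Add u' v')
| der_mul : forall u u' v v', derives Sigma u u' -> derives Sigma v v' ->
    derives Sigma (Mul u v) (Mul u' v').

Definition is_identity_basis (A : sig_alg) (Sigma : list identity) : Prop :=
  (forall e, List.In e Sigma -> holds A e) /\
  (forall u v, holds A (u, v) -> derives Sigma u v).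

Definition finitely_based (A : sig_alg) : Prop :=
  exists Sigma : list identity, is_identity_basis A Sigma.

Definition cmax (a b : 'I_3) : 'I_3 := if (a < b)%N then b else a.

Lemma val_cmax a b : nat_of_ord (cmax a b) = maxn a b.
Proof. by rewrite /cmax /maxn; case: ltnP. Qed.

(** endomorphisms of the semilattice C_3 = order-preserving maps *)
Definition monotone3 (f : {ffun 'I_3 -> 'I_3}) : Prop :=
  forall x y : 'I_3, (x <= y)%N -> (f x <= f y)%N.

Definition eadd (f g : {ffun 'I_3 -> 'I_3}) : {ffun 'I_3 -> 'I_3} :=
  [ffun x => cmax (f x) (g x)].
(** composition x(ab) = (xa)b *)
Definition emul (f g : {ffun 'I_3 -> 'I_3}) : {ffun 'I_3 -> 'I_3} :=
  [ffun x => g (f x)].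

Lemma monotone3_add f g : monotone3 f -> monotone3 g -> monotone3 (eadd f g).
Proof.
move=> hf hg x y hxy; rewrite !ffunE !val_cmax geq_max !leq_max.
by rewrite (hf _ _ hxy) (hg _ _ hxy) orbT.
Qed.

Lemma monotone3_mul f g : monotone3 f -> monotone3 g -> monotone3 (emul f g).
Proof. by move=> hf hg x y hxy; rewrite !ffunE; apply/hg/hf. Qed.

Definition EndC3_car := {f : {ffun 'I_3 -> 'I_3} | monotone3 f}.

Definition EndC3_add (a b : EndC3_car) : EndC3_car :=
  exist _ (eadd (proj1_sig a) (proj1_sig b))
    (monotone3_add (proj2_sig a) (proj2_sig b)).
Definition EndC3_mul (a b : EndC3_car) : EndC3_car :=
  exist _ (emul (proj1_sig a) (proj1_sig b))
    (monotone3_mul (proj2_sig a) (proj2_sig b)).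

Definition EndC3 : sig_alg := SigAlg EndC3_add EndC3_mul.

Definition fix2 (f : {ffun 'I_3 -> 'I_3}) : Prop := f ord_max = ord_max.

Lemma fix2_add f g : fix2 f -> fix2 g -> fix2 (eadd f g).
Proof. by rewrite /fix2 ffunE => -> ->; rewrite /cmax ltnn. Qed.

Lemma fix2_mul f g : fix2 f -> fix2 g -> fix2 (emul f g).
Proof. by rewrite /fix2 ffunE => -> ->. Qed.

Definition A21_car := {f : {ffun 'I_3 -> 'I_3} | monotone3 f /\ fix2 f}.

Definition A21_add (a b : A21_car) : A21_car :=
  exist _ (eadd (proj1_sig a) (proj1_sig b))
    (conj (monotone3_add (proj1 (proj2_sig a)) (proj1 (proj2_sig b)))
          (fix2_add (proj2 (proj2_sig a)) (proj2 (proj2_sig b)))).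
Definition A21_mul (a b : A21_car) : A21_car :=
  exist _ (emul (proj1_sig a) (proj1_sig b))
    (conj (monotone3_mul (proj1 (proj2_sig a)) (proj1 (proj2_sig b)))
          (fix2_mul (proj2 (proj2_sig a)) (proj2 (proj2_sig b)))).

Definition A21 : sig_alg := SigAlg A21_add A21_mul.

(* Main.v *)
From Stdlib Require Import ProofIrrelevance.
Require Import Defs.
From mathcomp Require Import all_boot zify.
Set Implicit Arguments. Unset Strict Implicit. Unset Printing Implicit Defensive.

(** Expand terms into finite sets of words. If [v] is a word of one side of an identity of A_2^1 and [a c b] is a factor of [v] (its two ends counting as letters), then some word [u] on the other side has a factor [a c' b] such that every letter of [c'] occurs in [c]: let [a] move the state 0 to 1, let [b] move 1 to the sink 2, let [c] act trivially and let all other letters reset to 0.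

Let [w] be a word in which no two-letter factor occurs twice and equal letters are far apart, compared with the number [n] of variables. Suppose that a substitution maps all words on one side of an [n]-variable identity of A_2^1 to the same factor [f] of [w]. A variable with a long value has only one possible position in [f], and the short ones between two long ones are pinned down by the domination property, so the words on the other side are also mapped to [f]. Hence no identity with [n] variables can change a term all of whose words are [w].

On the other hand [w] can be chosen with [w = pi w] in End(C_3), where [pi = x_0 ... x_(k-1)] is a prefix of [w]. If the value of [pi] is idempotent this is clear. Otherwise its square is constant, which forces the product [q p] of its last and first non-identity letters to be constant; so it is enough that [w] contains a factor [x_b u x_a] for all [a <= b], with [u] over the letters of [pi] outside [[a, b]]. *)

(** * Terms as sets of words *)

Fixpoint evalF (al : nat -> {ffun 'I_3 -> 'I_3}) (t : term) :
    {ffun 'I_3 -> 'I_3} :=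
  match t with
  | Var n => al n
  | Add s u => eadd (evalF al s) (evalF al u)
  | Mul s u => emul (evalF al s) (evalF al u)
  end.

Lemma val_eval_A21 (v : nat -> A21) t :
  proj1_sig (eval v t) = evalF (fun x => proj1_sig (v x)) t.
Proof. by elim: t => //= s IHs u IHu; rewrite -IHs -IHu. Qed.

Lemma val_eval_EndC3 (v : nat -> EndC3) t :
  proj1_sig (eval v t) = evalF (fun x => proj1_sig (v x)) t.
Proof. by elim: t => //= s IHs u IHu; rewrite -IHs -IHu. Qed.

(** Proof irrelevance removes the proofs carried by the elements, so both algebras can be handled
    through the same plain evaluation [evalF]. *)
Lemma holds_A21P e :
  holds A21 e <->
  (forall al, (forall x, monotone3 (al x) /\ fix2 (al x)) ->
    evalF al e.1 = evalF al e.2).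
Proof.
split=> [he al hal | he v].
  pose v x : A21 := exist _ (al x) (hal x).
  by rewrite -!(val_eval_A21 v) (he v).
refine (eq_sig_hprop (fun f => @proof_irrelevance _) _ _ _).
by rewrite !val_eval_A21 he // => x; case: (v x).
Qed.

Lemma holds_EndC3P e :
  holds EndC3 e <->
  (forall al, (forall x, monotone3 (al x)) -> evalF al e.1 = evalF al e.2).
Proof.
split=> [he al hal | he v].
  pose v x : EndC3 := exist _ (al x) (hal x).
  by rewrite -!(val_eval_EndC3 v) (he v).
refine (eq_sig_hprop (fun f => @proof_irrelevance _) _ _ _).
by rewrite !val_eval_EndC3 he // => x; case: (v x).
Qed.

Lemma holds_EndC3_A21 e : holds EndC3 e -> holds A21 e.
Proof.
by rewrite holds_EndC3P holds_A21P => he al hal; apply: he => x; case: (hal x).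
Qed.

(** Composition acts on the right, so a word is read from left to right by an automaton with states
    0, 1, 2. *)
Definition run (al : nat -> {ffun 'I_3 -> 'I_3}) (s : 'I_3) (w : seq nat) :=
  foldl (fun s x => al x s) s w.

Lemma run_cat al s w1 w2 : run al s (w1 ++ w2) = run al (run al s w1) w2.
Proof. exact: foldl_cat. Qed.

Lemma run_mono al w : (forall x, monotone3 (al x)) ->
  forall s s' : 'I_3, s <= s' -> run al s w <= run al s' w.
Proof. by move=> hal; elim: w => //= x w IHw s s' hs; apply/IHw/hal. Qed.

Fixpoint words (t : term) : seq (seq nat) :=
  match t with
  | Var n => [:: [:: n]]
  | Add s u => words s ++ words u
  | Mul s u => [seq x ++ y | x <- words s, y <- words u]
  end.

Lemma words_neq0 t : exists x, x \in words t.
Proof.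
elim: t => [n|s [x hx] u _|s [x hx] u [y hy]].
- by exists [:: n]; rewrite inE.
- by exists x; rewrite mem_cat hx.
- by exists (x ++ y); apply: allpairs_f.
Qed.

Lemma run_le_evalF al t s w : (forall x, monotone3 (al x)) ->
  w \in words t -> run al s w <= evalF al t s.
Proof.
move=> hal; elim: t s w => [n|t IHt u IHu|t IHt u IHu] s w /=.
- by rewrite inE => /eqP ->.
- rewrite mem_cat ffunE val_cmax leq_max => /orP[/IHt->|/IHu->] //.
  by rewrite orbT.
- case/allpairsP=> -[x y] /= [hx hy ->]; rewrite run_cat ffunE.
  by apply: leq_trans (IHu _ _ hy); apply: run_mono => //; apply: IHt.
Qed.

(** The states form a chain, so at each state a sum takes the value of one of its summands. Together
    with [run_le_evalF] this makes the value of a term the largest run over its words. *)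
Lemma evalF_run al t s : exists2 w, w \in words t & run al s w = evalF al t s.
Proof.
elim: t s => [n|t IHt u IHu|t IHt u IHu] s /=.
- by exists [:: n]; rewrite ?inE.
- rewrite ffunE /cmax; case: ifP => _.
    by have [w hw <-] := IHu s; exists w; rewrite // mem_cat hw orbT.
  by have [w hw <-] := IHt s; exists w; rewrite // mem_cat hw.
- have [x hx ex] := IHt s; have [y hy ey] := IHu (evalF al t s).
  exists (x ++ y); first exact: allpairs_f.
  by rewrite run_cat ex ey ffunE.
Qed.

(** * Domination between the two sides of an identity *)

Section Dominance.
Variables (a b : nat) (c : seq nat).

(** State 1 means that an [a] has been read and only letters of [c] since. Testing for [b] in state
    1 before testing for [a] covers the case [a = b]. *)
Definition link_step (x : nat) (s : 'I_3) : 'I_3 :=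
  if (s == 2 :> nat) || (x == b) && (s == 1 :> nat) then inord 2
  else if x == a then inord 1
  else if (x == b) || (x \in c) then s else inord 0.

Definition link_aut (x : nat) : {ffun 'I_3 -> 'I_3} := [ffun s => link_step x s].

Lemma val_link_aut x (s : 'I_3) : link_aut x s =
  (if (s == 2 :> nat) || (x == b) && (s == 1 :> nat) then 2
  else if x == a then 1
  else if (x == b) || (x \in c) then (s : nat) else 0) :> nat.
Proof. by rewrite ffunE /link_step; do ![case: ifP => _]; rewrite ?inordK. Qed.

Lemma link_aut_A21 x : monotone3 (link_aut x) /\ fix2 (link_aut x).
Proof.
split=> [s s' hs|]; last by apply: val_inj; rewrite /= val_link_aut.
have := ltn_ord s'; rewrite !val_link_aut; move: (x == a) (x == b) (x \in c) => [] [] [];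
  by case: (s : nat) hs => [|[|[|?]]]; case: (s' : nat) => [|[|[|?]]].
Qed.

Lemma run_link_aut_top p q :
  run link_aut ord0 (p ++ a :: c ++ b :: q) = 2 :> nat.
Proof.
have top (s : 'I_3) r : s = 2 :> nat -> run link_aut s r = 2 :> nat.
  by elim: r s => //= x r IHr s hs; apply: IHr; rewrite val_link_aut hs.
have mid (s : 'I_3) r : {subset r <= c} -> 0 < s -> 0 < run link_aut s r.
  elim: r s => //= x r IHr s hr hs; apply: IHr.
    by move=> y hy; apply: hr; rewrite inE hy orbT.
  by rewrite val_link_aut (hr x) ?mem_head // orbT; do ![case: ifP].
rewrite run_cat /= run_cat /=; apply: top.
set s := run _ _ c; have hs : 0 < s.
  apply: mid => //; rewrite val_link_aut; do ![case: ifP => //]; lia.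
rewrite val_link_aut eqxx /=; case: ifP => //; have := ltn_ord s; lia.
Qed.

Lemma run_link_aut_factor z : run link_aut ord0 z = 2 :> nat ->
  exists p d q, z = p ++ a :: d ++ b :: q /\ {subset d <= c}.
Proof.
pose F y := exists p d q, y = p ++ a :: d ++ b :: q /\ {subset d <= c}.
(* The induction on the last letter also needs the invariant of state 1: the word ends in an open
   link [a :: d]. *)
suff [//] : (run link_aut ord0 z = 2 :> nat -> F z) /\
  (run link_aut ord0 z = 1 :> nat ->
     exists p d, z = p ++ a :: d /\ {subset d <= c}).
elim/last_ind: z => [|z x [IH2 IH1]]; first by split.
have -> : run link_aut ord0 (rcons z x) = link_aut x (run link_aut ord0 z).
  by rewrite -cats1 run_cat.
rewrite val_link_aut; set s := run _ _ _ in IH1 IH2 *.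
case: ifP => [h|hn].
  split=> // _; case: (eqVneq (s : nat) 2) h => /= [/IH2 [p [d [q [-> hd]]]] _|_].
    by exists p, d, (rcons q x); rewrite rcons_cat /= rcons_cat.
  case/andP=> /eqP -> /eqP /IH1 [p [d [-> hd]]]; exists p, d, [::].
  by rewrite -cats1 -catA.
case: eqVneq => [->|hxa].
  by split=> // _; exists z, [::]; rewrite -cats1.
case: ifP => [hc|_]; last by split.
split=> hs; first by rewrite hs in hn.
have [p [d [-> hd]]] := IH1 hs; exists p, (rcons d x); split; first by rewrite rcons_cat.
move: hn hc; rewrite hs /= andbT => -> /= hc y.
by rewrite mem_rcons inE => /predU1P[->|/hd].
Qed.

End Dominance.

(* The letters [l] and [r] act as end markers, so that prefixes and suffixes of words are covered by the same statement as factors. *)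
Lemma A21_link_dominated (e : identity) l r v p a c b q :
  holds A21 e -> v \in words e.2 -> l :: v ++ [:: r] = p ++ a :: c ++ b :: q ->
  exists u p' c' q', [/\ u \in words e.1,
    l :: u ++ [:: r] = p' ++ a :: c' ++ b :: q' & {subset c' <= c}].
Proof.
move=> he hv ev; pose al := link_aut a b c.
have hm x : monotone3 (al x) by case: (link_aut_A21 a b c x).
(* From the state after [l], the word [u] realises the value of [e.1], which equals that of [e.2]
   and so bounds the run of [v]. Monotonicity of the map of [r] then takes the marked [u] to 2. *)
have [u hu eu] := evalF_run al e.1 (al l ord0).
have := run_link_aut_top a b c p q; rewrite -ev -/al /= run_cat /= => e2.
have hle : run al (al l ord0) v <= run al (al l ord0) u.
  rewrite eu ((holds_A21P e).1 he al (link_aut_A21 a b c)).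
  exact: run_le_evalF.
have e2' : run al ord0 (l :: u ++ [:: r]) = 2 :> nat.
  rewrite /= run_cat /=; apply/eqP; rewrite eqn_leq -ltnS ltn_ord /=.
  by apply: leq_trans (hm r _ _ hle); rewrite e2.
have [p' [c' [q' [eu' hc']]]] := run_link_aut_factor e2'.
by exists u, p', c', q'.
Qed.

(** * Words with unique two-letter factors *)

Definition unique_pairs (f : seq nat) := forall i j, i.+1 < size f -> j.+1 < size f ->
  nth 0 f i = nth 0 f j -> nth 0 f i.+1 = nth 0 f j.+1 -> i = j.

Definition spread (N : nat) (f : seq nat) := forall i j, i < j < size f ->
  nth 0 f i = nth 0 f j -> N < j - i.

Lemma not_uniq_bounded N (s : seq nat) : all (fun x => x < N) s -> N < size s -> ~~ uniq s.
Proof.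
move=> /allP hs; apply: contraL => us; rewrite -leqNgt -(size_iota 0 N).
by apply: uniq_leq_size => // x /hs; rewrite mem_iota.
Qed.

Lemma prefix_eq_size (T : eqType) (s1 s2 t1 t2 : seq T) :
  size s1 = size s2 -> s1 ++ t1 = s2 ++ t2 -> s1 = s2.
Proof. by move=> h /eqP; rewrite eqseq_cat // => /andP[/eqP]. Qed.

Lemma nth_factor (p s q : seq nat) i : i < size s ->
  nth 0 (p ++ s ++ q) (size p + i) = nth 0 s i.
Proof. by move=> hi; rewrite nth_cat ltnNge leq_addr /= addKn nth_cat hi. Qed.

Section Rigidity.
Variables (N : nat) (f : seq nat) (phi : nat -> seq nat).
Hypotheses (Uf : unique_pairs f) (Sf : spread N f).
Notation img u := (flatten (map phi u)).

Lemma img_cat u v : img (u ++ v) = img u ++ img v.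
Proof. by rewrite map_cat flatten_cat. Qed.

Definition small x := size (phi x) == 1.

Lemma size_img_small c : all small c -> size (img c) = size c.
Proof.
by elim: c => //= x c IHc /andP[/eqP hx hc]; rewrite size_cat hx IHc.
Qed.

Lemma nth_img_small c i : all small c -> i < size c ->
  nth 0 (img c) i = nth 0 (phi (nth 0 c i)) 0.
Proof.
elim: c i => //= x c IHc [|i] /andP[/eqP hx hc] hi; rewrite nth_cat hx //=.
by rewrite subn1 IHc.
Qed.

Lemma small_factor_spread p c q i j : f = p ++ img c ++ q -> all small c ->
  i < j < size c -> nth 0 c i = nth 0 c j -> N < j - i.
Proof.
move=> ef sc /andP[hij hjc] eij; have hic := ltn_trans hij hjc.
rewrite -(subnDl (size p)); apply: Sf.
  by rewrite ltn_add2l hij ef !size_cat size_img_small //; lia.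
by rewrite ef !nth_factor ?size_img_small // !nth_img_small // eij.
Qed.

(** Among [N.+1] letters below [N] one repeats; as each value is a single letter, [f] would repeat a
    letter within distance [N]. *)
Lemma small_factor_size p c q : f = p ++ img c ++ q -> all small c ->
  all (fun x => x < N) c -> size c <= N.
Proof.
move=> ef sc hc; rewrite leqNgt; apply/negP => hN.
have : ~~ uniq (take N.+1 c).
  apply: (@not_uniq_bounded N); last by rewrite size_takel.
  by apply/allP => x /mem_take /(allP hc).
case/(uniqPn 0) => i [j [hij]]; rewrite size_takel // => hj.
rewrite !nth_take //; last exact: ltn_trans hj; move=> eij.
have hjc : j < size c by apply: leq_trans hj _.
have := @small_factor_spread _ _ _ i j ef sc; rewrite hij hjc => /(_ isT eij).
lia.
Qed.

Lemma small_factor_uniq p c q : f = p ++ img c ++ q -> all small c ->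
  all (fun x => x < N) c -> uniq c.
Proof.
move=> ef sc hc; apply/negPn/negP => /(uniqPn 0) [i [j [hij hjc eij]]].
have hjN : j < N := leq_trans hjc (small_factor_size ef sc hc).
have := @small_factor_spread _ _ _ i j ef sc; rewrite hij hjc => /(_ isT eij).
lia.
Qed.

(** Here [us] stands for the marked words of one side, [a0 :: v] for a marked word of the other, and
    [a0] for the left marker. The long value of [a0] ensures that each nonempty prefix of [a0 :: v]
    has a last letter with a long value. *)
Variables (us : seq (seq nat)) (v : seq nat) (a0 : nat).
Hypothesis phi_us : forall u, u \in us -> img u = f.
Hypothesis bound_v : all (fun x => x < N) v.
Hypothesis phi_v : forall x, x \in v -> 0 < size (phi x).
Hypothesis big_a0 : 1 < size (phi a0).
Hypothesis us_a0 : exists u, a0 :: u \in us.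
Hypothesis dom : forall p a c b q, a0 :: v = p ++ a :: c ++ b :: q ->
  exists u p' c' q', [/\ u \in us, u = p' ++ a :: c' ++ b :: q' & {subset c' <= c}].

Lemma last_big v1 : exists p a c, [/\ a0 :: v1 = p ++ a :: c, 1 < size (phi a)
  & all (fun x => size (phi x) <= 1) c].
Proof.
elim/last_ind: v1 => [|v1 x [p [a [c [e ha hc]]]]]; first by exists [::], a0, [::].
case: (ltnP 1 (size (phi x))) => hx.
  by exists (a0 :: v1), x, [::]; rewrite -cats1.
exists p, a, (rcons c x); split=> //; last by rewrite all_rcons hx.
by rewrite -rcons_cons e rcons_cat.
Qed.

(** Induction on the prefix. The first two letters of the last long value [phi a] fix its position
    in [f]; domination and spread then force [phi b] to come right after the single letters that
    follow it. *)
Lemma img_prefix v1 v2 : v = v1 ++ v2 -> exists g, f = img (a0 :: v1) ++ g.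
Proof.
elim/last_ind: v1 v2 => [|v1 b IH] v2 ev.
  have [u hu] := us_a0; exists (img u).
  by rewrite -(phi_us hu) /= cats0.
rewrite cat_rcons in ev; have [g eg] := IH _ ev.
have [p [a [c [e1 ha hc0]]]] := last_big v1.
have cv : {subset c <= v}.
  move=> x hx; rewrite ev mem_cat; suff -> : x \in v1 by [].
  case: p e1 {ev eg} => [|y p] [_ ->] //; by rewrite mem_cat inE hx !orbT.
have hc : all small c.
  apply/allP => x hx; have := allP hc0 x hx; have := phi_v (cv x hx).
  by rewrite /small; lia.
have ev1 : a0 :: v = p ++ a :: c ++ b :: v2 by rewrite ev -cat_cons e1 -catA.
have [u [p' [c' [q' [hu eu hc']]]]] := dom ev1.
have sc' : all small c' by apply/allP => x /hc' /(allP hc).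
have bc : all (fun x => x < N) c by apply/allP => x /cv /(allP bound_v).
have bc' : all (fun x => x < N) c' by apply/allP => x /hc' /(allP bc).
have ef : f = img p ++ phi a ++ img c ++ g.
  by rewrite eg e1 img_cat /= -!catA.
have ef' : f = img p' ++ phi a ++ img c' ++ phi b ++ img q'.
  by rewrite -(phi_us hu) eu img_cat /= img_cat /=.
have esz : size (img p) = size (img p').
  apply: Uf.
  - rewrite ef !size_cat; lia.
  - rewrite ef' !size_cat; lia.
  - rewrite {1}ef ef' -[size (img p)]addn0 -[size (img p')]addn0.
    by rewrite !nth_factor // ltnW.
  - by rewrite {1}ef ef' -addn1 -[X in _ = nth _ _ X]addn1 !nth_factor.
have ep := prefix_eq_size esz (esym (etrans (esym ef') ef)).
have erest : img c ++ g = img c' ++ phi b ++ img q'.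
  move: ef'; rewrite {1}ef ep => /eqP; rewrite eqseq_cat // eqxx /=.
  by rewrite eqseq_cat // eqxx /= => /eqP.
have ucc' : uniq c'.
  apply: (@small_factor_uniq (img p' ++ phi a) c' (phi b ++ img q')) => //.
  by rewrite -catA.
have le_c : size c' <= size c by apply: uniq_leq_size.
case: (ltnP (size c') (size c)) => hlt; last first.
  have esc : size (img c) = size (img c').
    by rewrite !size_img_small //; lia.
  have ec := prefix_eq_size esc erest.
  exists (img q'); rewrite -rcons_cons e1 -cats1 -catA img_cat /= img_cat /= cats0.
  by rewrite ef' -!catA -ep ec.
(* If [c'] is shorter than [c], the values of [b] and of the letter [y] of [c] at that place start
   alike. Domination for the factor from [y] to [b] then yields two equal letters of [f] at distance
   at most [N]. *)
pose y := nth 0 c (size c').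
have yc : y \in c by apply: mem_nth.
have ey : nth 0 (phi y) 0 = nth 0 (phi b) 0.
  have := congr1 (fun s => nth 0 s (size c')) erest.
  rewrite !nth_cat !size_img_small // hlt nth_img_small // ltnn subnn.
  by rewrite phi_v ?ev ?mem_cat ?inE ?eqxx ?orbT.
have ev2 : a0 :: v = (p ++ a :: take (size c') c) ++ y :: drop (size c').+1 c ++ b :: v2.
  by rewrite ev1 -(cat_cons y) -(drop_nth 0 hlt) -catA cat_cons catA cat_take_drop.
have [u2 [p2 [c2 [q2 [hu2 eu2 hc2]]]]] := dom ev2.
have hc2c : {subset y :: c2 <= c}.
  by move=> x; rewrite inE => /predU1P[->//|/hc2/mem_drop].
have s2 : all small (y :: c2) by apply/allP => x /hc2c /(allP hc).
have b2 : all (fun x => x < N) (y :: c2) by apply/allP => x /hc2c /(allP bc).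
have ef2 : f = img p2 ++ img (y :: c2) ++ phi b ++ img q2.
  by rewrite -(phi_us hu2) eu2 img_cat /= img_cat /= -catA.
have := small_factor_size ef2 s2 b2.
have hb : 0 < size (phi b) by rewrite phi_v // ev mem_cat inE eqxx orbT.
have := @Sf (size (img p2) + 0) (size (img p2) + size (y :: c2)).
have -> : nth 0 f (size (img p2) + 0) = nth 0 (phi b) 0.
  by rewrite ef2 nth_factor ?(size_img_small s2) // nth_img_small.
have -> : nth 0 f (size (img p2) + size (y :: c2)) = nth 0 (phi b) 0.
  have -> : size (img p2) + size (y :: c2) = size (img p2 ++ img (y :: c2)).
    by rewrite size_cat (size_img_small s2).
  by rewrite ef2 catA -[size _]addn0 nth_factor.
have -> : size (img p2) + 0 < size (img p2) + size (y :: c2) < size f.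
  rewrite ef2 catA size_cat [size (_ ++ img _)]size_cat (size_img_small s2) size_cat.
  by rewrite /=; lia.
by move=> /(_ isT erefl); lia.
Qed.

End Rigidity.

Lemma unique_pairs_cons x f : x \notin f -> unique_pairs f -> unique_pairs (x :: f).
Proof.
move=> hx uf [|i] [|j] //= hi hj ei ej.
- by move: hx; rewrite ei mem_nth // ltnW.
- by move: hx; rewrite -ei mem_nth // ltnW.
- by congr S; apply: uf.
Qed.

Lemma unique_pairs_rcons f x : x \notin f -> unique_pairs f -> unique_pairs (rcons f x).
Proof.
move=> hx uf i j; rewrite size_rcons !ltnS => hi hj; rewrite !nth_rcons hi hj => ei.
case: (ltnP i.+1 (size f)) => hi1; case: (ltnP j.+1 (size f)) => hj1.
- exact: uf.
- rewrite (_ : j.+1 == size f); last by rewrite eqn_leq hj.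
  by move=> e; move: hx; rewrite -e mem_nth.
- rewrite (_ : i.+1 == size f); last by rewrite eqn_leq hi.
  by move=> e; move: hx; rewrite e mem_nth.
- by move=> _; apply/eqP; rewrite -eqSS eqn_leq (leq_trans hi) // (leq_trans hj).
Qed.

Lemma spread_cons N x f : x \notin f -> spread N f -> spread N (x :: f).
Proof.
move=> hx sf [|i] [|j] //= hj ej; last by rewrite subSS; apply: sf.
by move: hx; rewrite ej mem_nth.
Qed.

Lemma spread_rcons N f x : x \notin f -> spread N f -> spread N (rcons f x).
Proof.
move=> hx sf i j; rewrite size_rcons ltnS => /andP[hij hj].
have hi := leq_trans hij hj; rewrite !nth_rcons hi.
case: (ltnP j (size f)) => hj1; first by apply: sf; rewrite hij.
rewrite (_ : j == size f); last by rewrite eqn_leq hj.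
by move=> e; move: hx; rewrite -e mem_nth.
Qed.

(** * Terms with a single word under substitution and derivation *)

Definition only_word (t : term) (f : seq nat) := forall x, x \in words t -> x = f.

(** Fixing a word of one factor and cancelling it shows that all words of the other factor agree. *)
Lemma only_word_mul s u f : only_word (Mul s u) f ->
  exists f1 f2, [/\ f = f1 ++ f2, only_word s f1 & only_word u f2].
Proof.
have [x hx] := words_neq0 s; have [y hy] := words_neq0 u => h.
have cat_f x' y' : x' \in words s -> y' \in words u -> x' ++ y' = f.
  by move=> hx' hy'; apply: h; apply: allpairs_f.
exists x, y; split=> [|x' hx'|y' hy']; first by rewrite cat_f.
  have e := etrans (cat_f _ _ hx' hy) (esym (cat_f _ _ hx hy)).
  by apply: (prefix_eq_size _ e); have := congr1 size e; rewrite !size_cat => /addIn.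
have e := etrans (cat_f _ _ hx hy') (esym (cat_f _ _ hx hy)).
by move/eqP: e; rewrite eqseq_cat // eqxx => /eqP.
Qed.

Lemma words_size t w : w \in words t -> 0 < size w.
Proof.
elim: t w => [n|s IHs u IHu|s IHs u IHu] w /=.
- by rewrite inE => /eqP ->.
- by rewrite mem_cat => /orP[/IHs|/IHu].
- by case/allpairsP=> -[x y] /= [/IHs hx _ ->]; rewrite size_cat ltn_addr.
Qed.

Section Substitution.
Variable s : nat -> term.
(** Chosen as the word value of the letter [x]; when [s x] has only one word the choice is
    forced. *)
Definition first_word x := head [::] (words (s x)).

Lemma first_word_mem x : first_word x \in words (s x).
Proof.
rewrite /first_word; have [y] := words_neq0 (s x).
by case: (words (s x)) => //= z r _; rewrite mem_head.
Qed.

Lemma only_word_subst u f w x : only_word (subst s u) f ->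
  w \in words u -> x \in w -> only_word (s x) (first_word x).
Proof.
elim: u f w => [n|t IHt u IHu|t IHt u IHu] f w /= h.
- rewrite inE => /eqP ->; rewrite inE => /eqP -> y hy.
  by rewrite (h _ hy) (h _ (first_word_mem n)).
- rewrite mem_cat => /orP[hw|hw].
    by apply: IHt hw => y hy; apply: h; rewrite /= mem_cat hy.
  by apply: IHu hw => y hy; apply: h; rewrite /= mem_cat hy orbT.
- have [f1 [f2 [_ h1 h2]]] := only_word_mul h.
  case/allpairsP=> -[y z] /= [hy hz ->]; rewrite mem_cat => /orP[].
    exact: IHt h1 hy.
  exact: IHu h2 hz.
Qed.

Lemma words_subst_mem u w : w \in words u ->
  flatten (map first_word w) \in words (subst s u).
Proof.
elim: u w => [n|t IHt u IHu|t IHt u IHu] w /=.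
- by rewrite inE => /eqP -> /=; rewrite cats0 first_word_mem.
- by rewrite !mem_cat => /orP[/IHt->|/IHu->] //; rewrite orbT.
- case/allpairsP=> -[y z] /= [hy hz ->]; rewrite map_cat flatten_cat.
  by apply: allpairs_f; [apply: IHt | apply: IHu].
Qed.

Lemma words_substE u z :
  (forall w x, w \in words u -> x \in w -> only_word (s x) (first_word x)) ->
  z \in words (subst s u) ->
  exists2 w, w \in words u & z = flatten (map first_word w).
Proof.
elim: u z => [n|t IHt u IHu|t IHt u IHu] z /= h.
- move=> hz; exists [:: n]; rewrite ?mem_head //= cats0.
  by apply: (h [:: n] n); rewrite ?mem_head.
- rewrite mem_cat => /orP[hz|hz].
    have [|w hw ->] := IHt z _ hz; last by exists w; rewrite // mem_cat hw.
    by move=> w x hw; apply: h; rewrite mem_cat hw.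
  have [|w hw ->] := IHu z _ hz; last by exists w; rewrite // mem_cat hw orbT.
  by move=> w x hw; apply: h; rewrite mem_cat hw orbT.
- case/allpairsP=> -[y1 y2] /= [hy1 hy2 ->].
  (* Words of one factor are padded by a fixed word of the other, so that the hypothesis on the
     product applies. *)
  have [a ha] := words_neq0 t; have [b hb] := words_neq0 u.
  have [|w1 hw1 ->] := IHt y1 _ hy1.
    by move=> w x hw hx; apply: (h (w ++ b)); rewrite ?allpairs_f // mem_cat hx.
  have [|w2 hw2 ->] := IHu y2 _ hy2.
    by move=> w x hw hx; apply: (h (a ++ w)); rewrite ?allpairs_f // mem_cat hx orbT.
  by exists (w1 ++ w2); rewrite ?allpairs_f // map_cat flatten_cat.
Qed.

End Substitution.

Definition vars_below n (t : term) := forall w x, w \in words t -> x \in w -> x < n.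

(** The markers [n] and [n.+1] are not variables of [e] and count as letters in the bound [n.+2].
    With fresh values for them [f] becomes [f'], and [img_prefix] is applied to a whole marked word
    of [e.2]. *)
Lemma A21_only_word (e : identity) n s f : holds A21 e ->
  vars_below n e.1 -> vars_below n e.2 -> unique_pairs f -> spread n.+2 f ->
  only_word (subst s e.1) f -> only_word (subst s e.2) f.
Proof.
move=> he n1 n2 uf sf h1.
have dom := A21_link_dominated (l := n) (r := n.+1) he.
(* Domination for the factor from the marker [n] to [x] shows that [x] also occurs in a word of
   [e.1]. *)
have h2 w x : w \in words e.2 -> x \in w -> only_word (s x) (first_word s x).
  move=> hw hx; case/splitPr: hx hw => p q hw.
  have [u [p' [c' [q' [hu eu _]]]]] :=
    dom _ [::] n p x (q ++ [:: n.+1]) hw (congr1 (cons n) (esym (catA p (x :: q) _))).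
  apply: (only_word_subst h1 hu).
  have hxn : x < n by apply: (n2 _ _ hw); rewrite mem_cat mem_head orbT.
  have : x \in n :: u ++ [:: n.+1].
    by rewrite eu mem_cat inE mem_cat inE eqxx !orbT.
  by rewrite inE mem_cat inE => /or3P[/eqP|//|/eqP]; lia.
move=> z /(words_substE h2) [v hv ->] {z}.
pose K := (\max_(x <- f) x).+1.
have hK k : K + k \notin f.
  apply/negP => hk; suff : K + k <= \max_(x <- f) x by rewrite /K; lia.
  exact: (leq_bigmax_seq (F := id)).
(* The left marker gets a value of length 2, as [img_prefix] demands of [a0]; none of the letters
   [K], [K + 1], [K + 2] occurs in [f]. *)
pose phi x := if x == n then [:: K; K + 1]
  else if x == n.+1 then [:: K + 2] else first_word s x.
have phiE w t : vars_below n t -> w \in words t ->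
    map phi w = map (first_word s) w.
  move=> ht hw; apply/eq_in_map => x /(ht _ _ hw) hx.
  by rewrite /phi; case: eqP => [|_]; [lia | case: eqP => //; lia].
pose f' := [:: K, K + 1 & rcons f (K + 2)].
have hn1 : phi n.+1 = [:: K + 2].
  by rewrite /phi eqxx; case: eqP => //; lia.
have hn0 : phi n = [:: K; K + 1] by rewrite /phi eqxx.
have imgE w t : vars_below n t -> w \in words t ->
    flatten (map phi (n :: w ++ [:: n.+1])) =
    [:: K, K + 1 & rcons (flatten (map (first_word s) w)) (K + 2)].
  move=> ht hw; rewrite /= hn0 map_cat flatten_cat (phiE _ _ ht hw) /= hn1.
  by rewrite -cats1.
have k0 : K \notin (K + 1) :: rcons f (K + 2).
  by have := hK 0; rewrite inE mem_rcons inE addn0 !negb_or => ->; rewrite andbT; lia.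
have k1 : K + 1 \notin rcons f (K + 2).
  by rewrite mem_rcons inE negb_or hK andbT; lia.
have uf' : unique_pairs f'.
  by apply/unique_pairs_cons/unique_pairs_cons/unique_pairs_rcons.
have sf' : spread n.+2 f' by apply/spread_cons/spread_cons/spread_rcons.
pose us := [seq n :: u ++ [:: n.+1] | u <- words e.1].
have [] := @img_prefix n.+2 f' phi uf' sf' us (v ++ [:: n.+1]) n _ _ _ _ _ _
  (v ++ [:: n.+1]) [::].
- move=> _ /mapP[u hu ->]; rewrite (imgE _ _ n1 hu); congr [:: _, _ & rcons _ _].
  by apply: h1; apply: words_subst_mem.
- rewrite all_cat /= ltnSn !andbT; apply/allP => x /(n2 _ _ hv); lia.
- move=> x; rewrite mem_cat inE => /orP[hx|/eqP->]; last by rewrite hn1.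
  rewrite /phi; do 2![case: ifP => // _].
  exact: words_size (first_word_mem s x).
- by rewrite hn0.
- have [u hu] := words_neq0 e.1; exists (u ++ [:: n.+1]).
  by apply/mapP; exists u.
- move=> p a c b q ev; have [u [p' [c' [q' [hu eu hc]]]]] := dom v p a c b q hv ev.
  by exists (n :: u ++ [:: n.+1]), p', c', q'; split=> //; apply/mapP; exists u.
- by rewrite cats0.
move=> g; rewrite (imgE _ _ n2 hv) => -[]; set y := flatten _ => eg.
have hsz := congr1 size eg; rewrite size_cat !size_rcons in hsz.
(* The letter [K + 2] occurs only at the end of [f'], so nothing follows the image of the right
   marker. *)
case: (ltngtP (size y) (size f)) => hlt; last 2 [lia].
  have := congr1 (fun r => nth 0 r (size y)) eg.
  rewrite nth_cat size_rcons ltnSn !nth_rcons ltnn eqxx hlt => ey.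
  by have := hK 2; rewrite -ey mem_nth.
have eq2 : rcons f (K + 2) = rcons y (K + 2).
  by move: eg hsz; case: g => [|x g] /=; [rewrite cats0 | lia].
by have /eqP := eq2; rewrite eqseq_rcons => /andP[/eqP].
Qed.

Definition identities_below n (Sigma : seq identity) :=
  forall e, List.In e Sigma -> vars_below n e.1 /\ vars_below n e.2.

Lemma vars_below_exists t : exists n, vars_below n t.
Proof.
exists (\max_(w <- words t) \max_(x <- w) x).+1 => w x hw hx.
rewrite ltnS; apply: leq_trans (leq_bigmax_seq (F := fun w => \max_(x <- w) x) _ hw _) => //.
exact: (leq_bigmax_seq (F := id)).
Qed.

Lemma vars_below_leq n n' t : n <= n' -> vars_below n t -> vars_below n' t.
Proof. by move=> hn ht w x hw hx; apply: leq_trans hn; apply: ht hx. Qed.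

Lemma identities_below_exists Sigma : exists n, identities_below n Sigma.
Proof.
elim: Sigma => [|e Sigma [n hn]]; first by exists 0.
have [n1 h1] := vars_below_exists e.1; have [n2 h2] := vars_below_exists e.2.
exists (n + n1 + n2) => e' [<-|/hn [h1' h2']]; split.
- by apply: vars_below_leq h1; lia.
- by apply: vars_below_leq h2; lia.
- by apply: vars_below_leq h1'; lia.
- by apply: vars_below_leq h2'; lia.
Qed.

Lemma unique_pairs_factor p f q : unique_pairs (p ++ f ++ q) -> unique_pairs f.
Proof.
move=> u i j hi hj ei ej; apply: (@addnI (size p)); apply: u.
- rewrite !size_cat; lia.
- rewrite !size_cat; lia.
- by rewrite !nth_factor // ltnW.
- by rewrite -!addnS !nth_factor.
Qed.

Lemma spread_factor N p f q : spread N (p ++ f ++ q) -> spread N f.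
Proof.
move=> u i j /andP[hij hj] e; rewrite -(subnDl (size p)); apply: u.
  rewrite !size_cat; lia.
by rewrite !nth_factor //; lia.
Qed.

(** Induction on the derivation for all [f] at once: for a product, [f] splits into factors that
    inherit both conditions. For an axiom [A21_only_word] is used in both directions. *)
Lemma derives_only_word Sigma n s t f :
  (forall e, List.In e Sigma -> holds A21 e) -> identities_below n Sigma ->
  derives Sigma s t -> unique_pairs f -> spread n.+2 f ->
  only_word s f <-> only_word t f.
Proof.
move=> hS bS d; elim: d f => {s t}
  [u v s hin|t|u v _ IH|u v w _ IH1 _ IH2|u u' v v' _ IHu _ IHv|u u' v v' _ IHu _ IHv] f uf sf.
- have [b1 b2] := bS _ hin; have he := hS _ hin; split.
    exact: (@A21_only_word (u, v) n s f he).
  by apply: (@A21_only_word (v, u) n s f) => // al; rewrite (he al).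
- by [].
- by split=> h; apply/IH.
- by rewrite IH1 // IH2.
- have e x y : only_word (Add x y) f <-> only_word x f /\ only_word y f.
    split=> [h|[hx hy] z]; first by split=> z hz; apply: h; rewrite /= mem_cat hz ?orbT.
    by rewrite mem_cat => /orP[/hx|/hy].
  by rewrite !e IHu // IHv.
- have e x y : only_word (Mul x y) f <->
      exists f1 f2, [/\ f = f1 ++ f2, only_word x f1 & only_word y f2].
    split=> [|[f1 [f2 [-> h1 h2]]] z]; first exact: only_word_mul.
    by case/allpairsP=> -[a b] /= [/h1-> /h2-> ->].
  have facs f1 f2 : f = f1 ++ f2 ->
      [/\ unique_pairs f1, spread n.+2 f1, unique_pairs f2 & spread n.+2 f2].
    move=> ef; rewrite ef in uf sf; split.
    - exact: (@unique_pairs_factor [::] f1 f2).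
    - exact: (@spread_factor _ [::] f1 f2).
    - by apply: (@unique_pairs_factor f1 f2 [::]); rewrite cats0.
    - by apply: (@spread_factor _ f1 f2 [::]); rewrite cats0.
  rewrite !e; split=> -[f1 [f2 [ef h1 h2]]]; exists f1, f2;
    have [u1 s1 u2 s2] := facs _ _ ef; split=> //.
  + exact/(IHu _ u1 s1).
  + exact/(IHv _ u2 s2).
  + exact/(IHu _ u1 s1).
  + exact/(IHv _ u2 s2).
Qed.

(** * An absorption law in End(C_3) *)

(** The ten order-preserving self-maps of the chain as triples of values, so that statements about
    them can be decided by computation. *)
Definition maps3 : seq (nat * nat * nat) :=
  [:: (0,0,0); (0,0,1); (0,0,2); (0,1,1); (0,1,2); (0,2,2); (1,1,1); (1,1,2); (1,2,2); (2,2,2)].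

Definition app3 (t : nat * nat * nat) (s : nat) : nat :=
  match s with 0 => t.1.1 | 1 => t.1.2 | _ => t.2 end.

Lemma ord3_cases (P : 'I_3 -> Prop) :
  P (inord 0) -> P (inord 1) -> P (inord 2) -> forall s, P s.
Proof. by move=> h0 h1 h2 s; rewrite -(inord_val s); case: s => [[|[|[|]]]]. Qed.

Lemma maps3P (f : {ffun 'I_3 -> 'I_3}) : monotone3 f ->
  exists2 t, t \in maps3 & forall s, f s = app3 t s :> nat.
Proof.
move=> hf; exists (nat_of_ord (f (inord 0)), nat_of_ord (f (inord 1)), nat_of_ord (f (inord 2))).
  have h01 : f (inord 0) <= f (inord 1) by apply: hf; rewrite !inordK.
  have h12 : f (inord 1) <= f (inord 2) by apply: hf; rewrite !inordK.
  have := ltn_ord (f (inord 2)).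
  case: (nat_of_ord (f (inord 0))) h01 => [|[|[|?]]];
  case: (nat_of_ord (f (inord 1))) h12 => [|[|[|?]]];
  by case: (nat_of_ord (f (inord 2))) => [|[|[|?]]].
by apply: ord3_cases; rewrite inordK.
Qed.

Definition moves (f : {ffun 'I_3 -> 'I_3}) := [exists s, f s != s].

Lemma movesPn (f : {ffun 'I_3 -> 'I_3}) : reflect (forall s, f s = s) (~~ moves f).
Proof.
rewrite negb_exists; apply: (iffP forallP) => h s; first by apply/eqP/negPn.
by rewrite h eqxx.
Qed.

(** The only non-idempotent maps are [(0,0,1)] and [(1,2,2)], and their squares are constant. *)
Lemma idem_or_const (f : {ffun 'I_3 -> 'I_3}) : monotone3 f ->
  (forall s, f (f s) = f s) \/ (forall s s', f (f s) = f (f s')).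
Proof.
case/maps3P=> t ht et.
have chk : all (fun t => all (fun s => app3 t (app3 t s) == app3 t s) [:: 0; 1; 2] ||
  all (fun s => app3 t (app3 t s) == app3 t (app3 t 0)) [:: 0; 1; 2]) maps3 by vm_compute.
have in3 (s : 'I_3) : nat_of_ord s \in [:: 0; 1; 2] by case: s => [[|[|[|]]]].
have /orP[/allP h|/allP h] := allP chk t ht; [left=> s | right=> s s'];
  apply: ord_inj; rewrite !et; first exact/eqP/h/in3.
by rewrite (eqP (h _ (in3 s))) (eqP (h _ (in3 s'))).
Qed.

(* If [h := x |-> q (g (p x))] is not idempotent then it has rank 2 and [h \o h] is constant; since [h] has the kernel of [p] and the image of [q], already [p \o q] is constant. *)
Lemma idem_or_const_ends (p g q : {ffun 'I_3 -> 'I_3}) :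
  monotone3 p -> monotone3 g -> monotone3 q -> moves p -> moves q ->
  (forall s, q (g (p (q (g (p s))))) = q (g (p s))) \/
  (forall s s', p (q s) = p (q s')).
Proof.
case/maps3P=> tp hp ep /maps3P[tg hg eg] /maps3P[tq hq eq] mp mq.
have chk : all (fun p => all (fun g => all (fun q =>
    [|| all (fun s => app3 p s == s) [:: 0; 1; 2],
        all (fun s => app3 q s == s) [:: 0; 1; 2],
        all (fun s => app3 q (app3 g (app3 p (app3 q (app3 g (app3 p s))))) ==
                      app3 q (app3 g (app3 p s))) [:: 0; 1; 2] |
        all (fun s => app3 p (app3 q s) == app3 p (app3 q 0)) [:: 0; 1; 2]])
  maps3) maps3) maps3 by vm_compute.
have in3 (s : 'I_3) : nat_of_ord s \in [:: 0; 1; 2] by case: s => [[|[|[|]]]].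
have /or4P[/allP h|/allP h|/allP h|/allP h] := allP (allP (allP chk tp hp) tg hg) tq hq.
- by case/movesPn: mp => s; apply: ord_inj; rewrite ep; apply/eqP/h/in3.
- by case/movesPn: mq => s; apply: ord_inj; rewrite eq; apply/eqP/h/in3.
- by left=> s; apply: ord_inj; rewrite !(ep, eq, eg); apply/eqP/h/in3.
- right=> s s'; apply: ord_inj; rewrite !(ep, eq).
  by rewrite (eqP (h _ (in3 s))) (eqP (h _ (in3 s'))).
Qed.

Lemma run_id al w s : (forall x, x \in w -> ~~ moves (al x)) -> run al s w = s.
Proof.
elim: w s => //= x w IHw s h; rewrite ((movesPn _ (h x (mem_head _ _))) s).
by apply: IHw => y hy; apply: h; rewrite inE hy orbT.
Qed.

Lemma first_with (T : Type) (P : pred T) s : has P s ->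
  exists s1 x s2, [/\ s = s1 ++ x :: s2, P x & ~~ has P s1].
Proof.
elim: s => //= y s IH; case: (boolP (P y)) => [hy _|hy /= /IH [s1 [x [s2 [-> hx h1]]]]].
  by exists [::], y, s.
by exists (y :: s1), x, s2; rewrite /= negb_or hy.
Qed.

Lemma last_with (T : Type) (P : pred T) s : has P s ->
  exists s1 x s2, [/\ s = s1 ++ x :: s2, P x & ~~ has P s2].
Proof.
rewrite -has_rev => /first_with [s1 [x [s2 [e hx h1]]]].
exists (rev s2), x, (rev s1); split=> //; last by rewrite has_rev.
by rewrite -[s]revK e rev_cat rev_cons cat_rcons.
Qed.

Lemma iota_split_nth k s1 x s2 : iota 0 k = s1 ++ x :: s2 -> x = size s1 /\ size s1 < k.
Proof.
move=> e; have hs : size s1 < k.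
  by rewrite -(size_iota 0 k) e size_cat /=; lia.
by have := nth_iota 0 0 hs; rewrite e nth_cat ltnn subnn /= add0n.
Qed.

(* Between [b] and [a] only letters outside [[a, b]] are allowed: when [a] and [b] carry the first and the last non-identity maps, those letters act trivially. *)
Lemma run_prefix_absorb k w al :
  (forall a b, a <= b < k -> exists p u q, w = p ++ b :: u ++ a :: q /\
     forall x, x \in u -> (x < a) || (b < x < k)) ->
  (exists v, w = iota 0 k ++ v) -> (forall x, monotone3 (al x)) ->
  forall s, run al s (iota 0 k ++ w) = run al s w.
Proof.
move=> hw [v ev] hal s.
(* Since [w] starts with [iota 0 k], idempotence absorbs the extra copy. *)
have idem_case : (forall s, run al (run al s (iota 0 k)) (iota 0 k) = run al s (iota 0 k)) ->
    run al s (iota 0 k ++ w) = run al s w.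
  by move=> h; rewrite ev !run_cat h.
(* The letters between [b] and [a] act trivially, so after this factor of [w] the state no longer
   depends on the start. *)
have const_case a b : a <= b < k ->
    (forall x, (x < a) || (b < x < k) -> ~~ moves (al x)) ->
    (forall s s', al a (al b s) = al a (al b s')) ->
    run al s (iota 0 k ++ w) = run al s w.
  move=> hab hid hc; have [p [u [q [-> hu]]]] := hw a b hab.
  have hru r : run al r u = r by apply: run_id => x /hu /hid.
  by rewrite run_cat !(run_cat, hru) /= !run_cat /= !hru; congr run; apply: hc.
have idP l : ~~ has (fun x => moves (al x)) l -> forall r, run al r l = r.
  by move=> /hasPn h r; apply: run_id.
case: (boolP (has (fun x => moves (al x)) (iota 0 k))) => [|/idP h]; last first.
  by rewrite run_cat h.
case/first_with=> A [a [R [eA ma hA]]]; have [ea hak] := iota_split_nth eA.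
case: (boolP (has (fun x => moves (al x)) R)) => [|hR].
  case/last_with=> H [b [B [eR mb hB]]]; rewrite eR in eA.
  have eA' : iota 0 k = (A ++ a :: H) ++ b :: B by rewrite -catA.
  have [eb hbk] := iota_split_nth eA'; rewrite size_cat /= in eb hbk.
  have rpi r : run al r (iota 0 k) = al b (run al (al a r) H).
    by rewrite eA run_cat (idP _ hA) /= run_cat /= (idP _ hB).
  pose g : {ffun 'I_3 -> 'I_3} := [ffun r => run al r H].
  have hg : monotone3 g by move=> x y hxy; rewrite !ffunE; apply: run_mono.
  have [h|h] := idem_or_const_ends (hal a) hg (hal b) ma mb.
    by apply: idem_case => r; rewrite !rpi; have := h r; rewrite !ffunE.
  apply: (@const_case a b) => //; first by lia.
  move=> x hx; have hxk : x \in iota 0 k by rewrite mem_iota; lia.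
  (* Each letter of [iota 0 k] is its own position, so letters below [a] lie in [A] and those above
     [b] lie in [B]. *)
  have xE : x = nth 0 (iota 0 k) x by rewrite nth_iota //; lia.
  case/orP: hx => hx.
    move/hasPn: hA; apply; rewrite xE eA nth_cat -ea hx mem_nth // -ea //.
  move/hasPn: hB; apply; rewrite xE eA' nth_cat size_cat /= -eb.
  case: ltnP => [|_]; first by lia.
  have : size (iota 0 k) = b + (size B).+1 by rewrite eA' size_cat /= size_cat /= eb.
  rewrite size_iota => ek; have -> : x - b = (x - b).-1.+1 by lia.
  have hsz : (x - b).-1 < size B by lia.
  by rewrite /= mem_nth.
(* Only one letter moves a state, so it is both the first and the last such letter. *)
have rpi r : run al r (iota 0 k) = al a r.
  by rewrite eA run_cat (idP _ hA) /= (idP _ hR).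
have [h|h] := idem_or_const (hal a); first by apply: idem_case => r; rewrite !rpi.
apply: (@const_case a a) => //; first by lia.
move=> x hx; have : x \in iota 0 k by rewrite mem_iota; lia.
rewrite eA mem_cat inE => /or3P[hx'|/eqP|hx'].
- by move/hasPn: hA; apply.
- lia.
- by move/hasPn: hR; apply.
Qed.

Fixpoint word_term (x : nat) (w : seq nat) : term :=
  if w is y :: w' then Mul (Var x) (word_term y w') else Var x.

Lemma words_word_term x w : words (word_term x w) = [:: x :: w].
Proof. by elim: w x => //= y w IHw x; rewrite IHw. Qed.

Lemma evalF_word_term al x w s : evalF al (word_term x w) s = run al s (x :: w).
Proof. by elim: w x s => //= y w IHw x s; rewrite ffunE IHw. Qed.

(** * The long word *)

(* The first [4 * m] letters of the long word: [0 .. 2m-1], then [m-1 .. 0], then [2m-1 .. m]. *)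
Definition base m i :=
  if i < 2 * m then i else if i < 3 * m then 3 * m - i.+1 else 5 * m - i.+1.

Lemma base_lt m i : i < 4 * m -> base m i < 2 * m.
Proof. by rewrite /base; do ![case: ifP => ?]; lia. Qed.

(** Adjacent letters rise by 1 in the first run and fall by 1 in the other two. The junctions
    [(2m-1, m-1)] and [(0, 2m-1)] have larger jumps once [m > 1]. *)
Lemma base_unique m i j : i.+1 < 4 * m -> j.+1 < 4 * m -> 1 < m ->
  base m i = base m j -> base m i.+1 = base m j.+1 -> i = j.
Proof. rewrite /base; do ![case: ifP => ?]; lia. Qed.

(** A letter [x < m] stands at [x] and [3m-1-x], a letter [x >= m] at [x] and [5m-1-x]; both
    distances are at least [m+1]. *)
Lemma base_spread m i j : i < j < 4 * m -> base m i = base m j -> m < j - i.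
Proof. by rewrite /base; do ![case: ifP => ?]; lia. Qed.

Definition base_pair m b a :=
  has (fun i => (base m i == b) && (base m i.+1 == a)) (iota 0 (4 * m).-1).

(* After position [4 * m] come blocks of [m + 2] letters, one for each pair [(b, a)] of numbers below [2 * m]. A block ends with [b a] if [a < b] and [b a] has not occurred yet; all its other letters are fresh. *)
Definition letter m i :=
  if i < 4 * m then base m i else
  let q := (i - 4 * m) %/ m.+2 in let r := (i - 4 * m) %% m.+2 in
  let b := q %/ (2 * m) in let a := q %% (2 * m) in
  if [&& a < b, ~~ base_pair m b a & r == m] then b else
  if [&& a < b, ~~ base_pair m b a & r == m.+1] then a else 2 * m + i.

Definition len m := 4 * m + (2 * m * (2 * m)) * m.+2.

Variant letter_spec m i : nat -> Prop :=
| LetterBase of i < 4 * m : letter_spec m i (base m i)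
| LetterFresh of 4 * m <= i : letter_spec m i (2 * m + i)
| LetterFst b a of a < b < 2 * m & ~~ base_pair m b a &
    i = 4 * m + (b * (2 * m) + a) * m.+2 + m : letter_spec m i b
| LetterSnd b a of a < b < 2 * m & ~~ base_pair m b a &
    i = 4 * m + (b * (2 * m) + a) * m.+2 + m.+1 : letter_spec m i a.

Lemma letterP m i : 0 < m -> i < len m -> letter_spec m i (letter m i).
Proof.
move=> m0 hi; rewrite /letter; case: ltnP => hi4; first exact: LetterBase.
have eD := divn_eq (i - 4 * m) m.+2.
set q := _ %/ m.+2 in eD *; set r := _ %% m.+2 in eD *; cbv zeta.
have eq := divn_eq q (2 * m).
have ha : q %% (2 * m) < 2 * m by rewrite ltn_mod; lia.
have hb : q %/ (2 * m) < 2 * m.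
  rewrite ltn_divLR; last by lia.
  rewrite /q ltn_divLR //; move: hi; rewrite /len; lia.
case: ifP => [/and3P[hab hp /eqP hr]|_].
  by apply: (LetterFst (a := q %% (2 * m))); rewrite ?hab -?eq //; lia.
case: ifP => [/and3P[hab hp /eqP hr]|_]; last exact: LetterFresh.
by apply: (LetterSnd (b := q %/ (2 * m))); rewrite ?hab -?eq //; lia.
Qed.

Lemma divmod_uniq d q r q' r' : r < d -> r' < d -> q * d + r = q' * d + r' ->
  q = q' /\ r = r'.
Proof.
move=> hr hr' e; have hd : 0 < d by lia.
have := congr1 (divn^~ d) e; have := congr1 (modn^~ d) e.
by rewrite !modnMDl !divnMDl // !modn_small // !divn_small // !addn0.
Qed.

(** A fresh letter encodes its own position, hence occurs only once. *)
Lemma letter_fresh m i : 0 < m -> i < len m -> 2 * m <= letter m i ->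
  letter m i = 2 * m + i.
Proof.
move=> m0 hi; case: letterP => //.
- by move=> /base_lt; lia.
- by move=> b a; lia.
- by move=> b a; lia.
Qed.

(** Beyond the base only offsets [m] and [m.+1] of a block can carry letters below [2 * m]. Two
    adjacent ones therefore end a block, and the pair determines the number of that block. *)
Lemma letter_pair m i : 0 < m -> i.+1 < len m -> letter m i < 2 * m ->
  letter m i.+1 < 2 * m -> 4 * m <= i.+1 ->
  ~~ base_pair m (letter m i) (letter m i.+1) /\
  i = 4 * m + (letter m i * (2 * m) + letter m i.+1) * m.+2 + m.
Proof.
move=> m0 hi1; have hi := ltnW hi1.
case: (letterP m0 hi1) => [|_|b a hab hp e|b a hab hp e]; first by lia.
- by lia.
- move=> + _ _; case: (letterP m0 hi) => [|_|b' a' h' _ e'|b' a' h' _ e'].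
  + by lia.
  + by lia.
  + have [] := @divmod_uniq m.+2 (b' * (2 * m) + a') m (b * (2 * m) + a) m.-1; lia.
  + have [] := @divmod_uniq m.+2 (b' * (2 * m) + a') m.+1 (b * (2 * m) + a) m.-1; lia.
- move=> + _ _; case: (letterP m0 hi) => [|_|b' a' h' hp' e'|b' a' h' _ e'].
  + by lia.
  + by lia.
  + have [||//|eq _] := @divmod_uniq m.+2 (b' * (2 * m) + a') m (b * (2 * m) + a) m;
      try lia.
    have [||//|-> _] := @divmod_uniq (2 * m) b' a' b a; try lia.
  + have [] := @divmod_uniq m.+2 (b' * (2 * m) + a') m.+1 (b * (2 * m) + a) m; lia.
Qed.

Lemma base_pairP m i : i.+1 < 4 * m -> base_pair m (base m i) (base m i.+1).
Proof.
by move=> hi; apply/hasP; exists i; rewrite ?eqxx // mem_iota; lia.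
Qed.

Lemma letter_base m i : i < 4 * m -> letter m i = base m i.
Proof. by rewrite /letter => ->. Qed.

Definition long_word m := mkseq (letter m) (len m).

Lemma size_long_word m : size (long_word m) = len m.
Proof. exact: size_mkseq. Qed.

Lemma unique_pairs_long_word m : 1 < m -> unique_pairs (long_word m).
Proof.
move=> m1 i j; rewrite size_long_word => hi hj.
have [hi' hj'] := (ltnW hi, ltnW hj); rewrite !nth_mkseq //.
have m0 : 0 < m by lia.
case: (leqP (2 * m) (letter m i)) => hli e1 e2.
  have := letter_fresh m0 hi' hli; rewrite e1 in hli *.
  by rewrite (letter_fresh m0 hj' hli); lia.
case: (leqP (2 * m) (letter m i.+1)) => hli1.
  have := letter_fresh m0 hi hli1; rewrite e2 in hli1 *.
  by rewrite (letter_fresh m0 hj hli1); lia.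
have hlj : letter m j < 2 * m by rewrite -e1.
have hlj1 : letter m j.+1 < 2 * m by rewrite -e2.
(* In the mixed cases the pairs differ, because a block ends only with a pair that does not occur in
   the base. *)
case: (ltnP i.+1 (4 * m)) => hi4; case: (ltnP j.+1 (4 * m)) => hj4.
- rewrite !letter_base in e1 e2; try lia; exact: (@base_unique m).
- have [] := letter_pair m0 hj hlj hlj1 hj4.
  by rewrite -e1 -e2 !letter_base ?base_pairP //; lia.
- have [] := letter_pair m0 hi hli hli1 hi4.
  by rewrite e1 e2 !letter_base ?base_pairP //; lia.
- have [_ ei] := letter_pair m0 hi hli hli1 hi4; rewrite e1 e2 in ei.
  by have [_ ej] := letter_pair m0 hj hlj hlj1 hj4; apply: etrans ei (esym ej).
Qed.

Lemma letter_offset m i : 0 < m -> i < len m -> 4 * m <= i -> letter m i < 2 * m ->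
  exists b a, a < b < 2 * m /\
   (letter m i = b /\ i = 4 * m + (b * (2 * m) + a) * m.+2 + m \/
    letter m i = a /\ i = 4 * m + (b * (2 * m) + a) * m.+2 + m.+1).
Proof.
move=> m0 hi; case: letterP => //; try lia.
  by move=> b a hab _ e _ _; exists b, a; split=> //; left.
by move=> b a hab _ e _ _; exists b, a; split=> //; right.
Qed.

(** The block length [m.+2] is chosen for this: offsets [m] and [m.+1] of different blocks are at
    least [m+1] apart, and offset [m] is far enough from the base. Within one block the two letters
    differ. *)
Lemma spread_long_word m : 0 < m -> spread m (long_word m).
Proof.
move=> m0 i j; rewrite size_long_word => /andP[hij hj].
have hi := ltn_trans hij hj; rewrite !nth_mkseq // => e.
case: (leqP (2 * m) (letter m i)) => hli.
  have := letter_fresh m0 hi hli; rewrite e in hli *.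
  by rewrite (letter_fresh m0 hj hli); lia.
have hlj : letter m j < 2 * m by rewrite -e.
case: (ltnP j (4 * m)) => hj4.
  by rewrite !letter_base in e; try lia; apply: base_spread e; rewrite hij.
have [b' [a' [hab' hj']]] := letter_offset m0 hj hj4 hlj.
case: (ltnP i (4 * m)) => hi4; first by case: hj' => -[]; lia.
have [b [a [hab hi']]] := letter_offset m0 hi hi4 hli.
set q := b * (2 * m) + a in hi'; set q' := b' * (2 * m) + a' in hj'.
have [hq|hq|hq] := ltngtP q q'.
- have : q.+1 * m.+2 <= q' * m.+2 by rewrite leq_mul2r hq orbT.
  by rewrite mulSn; case: hi' hj' => -[_ ?] [] [_ ?]; lia.
- have : q'.+1 * m.+2 <= q * m.+2 by rewrite leq_mul2r hq orbT.
  by rewrite mulSn; case: hi' hj' => -[_ ?] [] [_ ?]; lia.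
have [||//|eb ea] := @divmod_uniq (2 * m) b a b' a'; lia.
Qed.

Lemma long_word_cut m i : i < len m ->
  long_word m = take i (long_word m) ++ letter m i :: drop i.+1 (long_word m).
Proof.
move=> hi; rewrite -[in LHS](cat_take_drop i (long_word m)).
by rewrite (drop_nth 0) ?size_long_word // nth_mkseq.
Qed.

Lemma long_word_factor m i j : i < j < len m ->
  exists p u q, long_word m = p ++ letter m i :: u ++ letter m j :: q /\
    forall x, x \in u -> exists2 k, i < k < j & x = letter m k.
Proof.
move=> /andP[hij hj]; have hi := ltn_trans hij hj.
have hsz := size_long_word m.
pose D := drop i.+1 (long_word m); pose d := j - i.+1.
have hd : d < size D by rewrite size_drop hsz /d; lia.
have nD k : k < size D -> nth 0 D k = letter m (i.+1 + k).
  by rewrite size_drop hsz => hk; rewrite nth_drop nth_mkseq //; lia.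
exists (take i (long_word m)), (take d D), (drop d.+1 D); split.
  rewrite {1}(long_word_cut hi); congr (_ ++ _ :: _).
  rewrite -/D -[in LHS](cat_take_drop d D) (drop_nth 0 hd) nD //.
  by congr (_ ++ letter m _ :: _); rewrite /d; lia.
move=> x /(nthP 0)[k]; rewrite size_takel ?(ltnW hd) // => hk <-.
by exists (i.+1 + k); [rewrite /d in hk; lia | rewrite nth_take // nD // (ltn_trans hk)].
Qed.

(** For [a = b] the two occurrences in the base serve. For [a < b] the letters [b], [a] are
    adjacent, in the base or at the end of their block, so [u] is empty. *)
Lemma long_word_links m a b : 0 < m -> a <= b < 2 * m ->
  exists p u q, long_word m = p ++ b :: u ++ a :: q /\
    forall x, x \in u -> (x < a) || (b < x < 2 * m).
Proof.
move=> m0 /andP[hab hb].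
have hlen : 4 * m <= len m by rewrite /len leq_addr.
move: hab; rewrite leq_eqVlt => /orP[/eqP eab|hab].
  rewrite -eab in hb *.
  (* The second position of [a] in the base. *)
  pose j := if a < m then 3 * m - a.+1 else 5 * m - a.+1.
  have hj : a < j < 4 * m by rewrite /j; case: ifP; lia.
  have [|p [u [q [e hu]]]] := @long_word_factor m a j; first by lia.
  have ea : letter m a = a by rewrite letter_base /base ?hb //; lia.
  have ej : letter m j = a.
    rewrite letter_base ?(andP hj).2 //; move: hj; rewrite /base /j.
    by case: (ltnP a m) => ? ?; do ![case: ifP => ?]; lia.
  rewrite ea ej in e; exists p, u, q; split=> // x /hu [k hk ->].
  rewrite letter_base; last by lia.
  have hk4 : k < 4 * m by lia.
  have := base_lt hk4; suff : base m k != a by lia.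
  by move: hk; rewrite /base /j; case: (ltnP a m) => ? ?; do ![case: ifP => ?]; lia.
suff [i hi [<- <-]] : exists2 i, i.+1 < len m & letter m i = b /\ letter m i.+1 = a.
  have [|p [u [q [e hu]]]] := @long_word_factor m i i.+1; first by rewrite ltnSn.
  by exists p, u, q; split=> // x /hu [k]; lia.
case: (boolP (base_pair m b a)) => [/hasP[i]|hp].
  rewrite mem_iota => hi /andP[/eqP <- /eqP <-].
  by exists i; rewrite ?letter_base //; lia.
set q := b * (2 * m) + a.
have hq : q < 2 * m * (2 * m).
  have : b.+1 * (2 * m) <= 2 * m * (2 * m) by rewrite leq_mul2r hb orbT.
  by rewrite mulSn /q; lia.
have hq2 : q.+1 * m.+2 <= 2 * m * (2 * m) * m.+2 by rewrite leq_mul2r hq orbT.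
rewrite mulSn in hq2.
have qd : q %/ (2 * m) = b by rewrite /q divnMDl ?divn_small ?addn0; lia.
have qm : q %% (2 * m) = a by rewrite /q modnMDl modn_small; lia.
have dm r : r < m.+2 -> (q * m.+2 + r) %/ m.+2 = q /\ (q * m.+2 + r) %% m.+2 = r.
  by move=> hr; rewrite divnMDl // modnMDl divn_small // modn_small // addn0.
exists (4 * m + q * m.+2 + m); first by rewrite /len; lia.
have [d0 r0] := dm m (ltnW (ltnSn _)); have [d1 r1] := dm m.+1 (ltnSn _).
split; rewrite /letter.
  rewrite ifN; last by lia.
  by rewrite -(addnA (4 * m)) addKn d0 r0 qd qm hab hp eqxx.
rewrite ifN; last by lia.
by rewrite -addnS -(addnA (4 * m)) addKn d1 r1 qd qm hab hp eqxx /= ifN //; lia.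
Qed.

Lemma long_word_prefix m : exists v, long_word m = iota 0 (2 * m) ++ v.
Proof.
have hl : 2 * m <= len m by rewrite /len; lia.
exists (drop (2 * m) (long_word m)).
rewrite -[in LHS](cat_take_drop (2 * m) (long_word m)); congr (_ ++ _).
apply: (@eq_from_nth _ 0); rewrite size_takel ?size_long_word ?size_iota // => i hi.
rewrite nth_take // nth_mkseq ?nth_iota ?(leq_trans hi) //.
by rewrite letter_base /base ?hi //; lia.
Qed.

(** * The long identities and the conclusion *)

Definition term_of_word (w : seq nat) := word_term (head 0 w) (behead w).

Lemma EndC3_long_identity m : 0 < m ->
  holds EndC3 (term_of_word (long_word m), term_of_word (iota 0 (2 * m) ++ long_word m)).
Proof.
move=> m0; apply/holds_EndC3P => al hal; apply/ffunP => s /=.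
have [v ev] := long_word_prefix m.
have h := run_prefix_absorb (fun a b => @long_word_links m a b m0)
  (long_word_prefix m) hal s.
rewrite /term_of_word !evalF_word_term.
have cons_head w : 0 < size w -> head 0 w :: behead w = w by case: w.
rewrite !cons_head //; first by rewrite size_cat size_iota; lia.
by rewrite size_long_word /len; lia.
Qed.

(** Allowing any [A] whose identities lie between those of [EndC3] and [A21] treats both algebras at
    once. The parameter [n.+2] of the long word is the spread needed for identities in variables
    below [n]. *)
Lemma no_finite_basis (A : sig_alg) :
  (forall e, holds EndC3 e -> holds A e) -> (forall e, holds A e -> holds A21 e) ->
  ~ finitely_based A.
Proof.
move=> hE hA [Sigma [hS hB]].
have [n hn] := identities_below_exists Sigma.
have m0 : 0 < n.+2 by [].
have d := hB _ _ (hE _ (EndC3_long_identity m0)).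
have hw : only_word (term_of_word (long_word n.+2)) (long_word n.+2).
  move=> x; rewrite words_word_term inE => /eqP ->.
  by case: (long_word n.+2) (size_long_word n.+2).
have [/(_ hw) h _] := derives_only_word (fun e he => hA _ (hS e he)) hn d
  (@unique_pairs_long_word n.+2 isT) (spread_long_word m0).
(* The word on the other side would equal the long word, but it is longer by [2 * n.+2] letters. *)
have := h (iota 0 (2 * n.+2) ++ long_word n.+2).
rewrite words_word_term inE eqxx => /(_ isT) /(congr1 size).
by rewrite size_cat size_iota; lia.
Qed.

Theorem theorem6p2 : ~ finitely_based A21 /\ ~ finitely_based EndC3.
Proof.
by split; apply: no_finite_basis => // e; apply: holds_EndC3_A21.
Qed.
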